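(* Let $V$ be a real vector space of dimension $r$ and $\mathcal{A}$ a finite set of distinct linear hyperplanes in $V$ whose common intersection is $\{0\}$. If $\mathcal{A}$ is chordal, then $\mathcal{A}$ satisfies Yoshinaga's criterion.
   Context: Choose for each $H\in\mathcal{A}$ a coorientation, i.e. label the two components of $V\setminus H$ as $H^+$ and $H^-$ (the criterion below does not depend on this choice). For $\epsilon\in\{\pm\}^{\mathcal{A}}$ and $S\subseteq\mathcal{A}$, $H_S^\epsilon=\bigcap_{H\in S}H^{\epsilon_H}$; $\epsilon$ is $k$-consistent if $H_S^\epsilon\ne\emptyset$ for every $S$ with $|S|\le k+1$, and $\sigma_k$ is the number of $k$-consistent sign vectors. $\mathcal{A}$ satisfies Yoshinaga's criterion if $\sigma_2=\sigma_r$. The matroid of $\mathcal{A}$ has ground set $\mathcal{A}$, a subset being independent iff linear forms defining its hyperplanes are linearly independent; circuits are minimal dependent subsets. A matroid is chordal if for every circuit $C$ with $|C|\ge4$ there are circuits $D_1,D_2$ with $|D_1\cap D_2|=1$ and $C=(D_1\cup D_2)\setminus(D_1\cap D_2)$. $\mathcal{A}$ is chordal if its matroid is chordal. *)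

(* Defs.v *)
From mathcomp Require Import all_boot all_order all_algebra finmap.
From mathcomp Require Import boolp classical_sets reals topology normedtype.
Import numFieldNormedType.Exports.

Set Implicit Arguments.
Unset Strict Implicit.
Unset Printing Implicit Defensive.

Local Open Scope fset_scope.
Local Open Scope classical_set_scope.
Local Open Scope ring_scope.

Definition is_circuit (T : finType) (indep : {set T} -> Prop) (C : {set T}) :
    Prop :=
  minset (fun S : {set T} => ~~ `[< indep S >]) C.

(* The matroid on the ground set [T] is given by its independent sets. *)
Definition chordal_matroid (T : finType) (indep : {set T} -> Prop) : Prop :=
  forall C : {set T}, is_circuit indep C -> (4 <= #|C|)%N ->
  exists D1 D2 : {set T},
    [/\ is_circuit indep D1, is_circuit indep D2,
        #|D1 :&: D2| = 1%N & C = (D1 :|: D2) :\: (D1 :&: D2)].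

Definition is_hyperplane (R : realType) (V : vectType R) (H : {vspace V}) :
    Prop :=
  (\dim H).+1 = \dim {:V}.

(* [A] is a finite set of distinct hyperplanes with common intersection 0;
   for empty [A] the big intersection is the whole space. *)
Definition is_essential_arrangement (R : realType) (V : vectType R)
    (A : {fset {vspace V}}) : Prop :=
  (forall H, H \in A -> is_hyperplane H) /\
  (\bigcap_(H <- A) H)%VS = 0%VS.

(* Linear forms with a prescribed hyperplane as kernel are unique up to nonzero
   scalars, so the choice of the forms [f] is immaterial. *)
Definition arr_indep (R : realType) (V : vectType R) (A : {fset {vspace V}})
    (S : {set A}) : Prop :=
  exists f : A -> 'Hom(V, R^o),
    (forall H : A, lker (f H) = val H) /\ free [seq f H | H <- enum S].

Definition chordal_arrangement (R : realType) (V : vectType R)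
    (A : {fset {vspace V}}) : Prop :=
  chordal_matroid (@arr_indep R V A).

Definition vcoords (R : realType) (V : vectType R) (v : V) :
    'rV[R]_(\dim {:V}) :=
  \row_i coord (vbasis {:V}) i v.

(* Connected components of [X] for the usual topology of the finite-dimensional
   space [V].  The library puts no topology on a [vectType], so it is transported
   from [R^n] along coordinates; it does not depend on the basis. *)
Definition components (R : realType) (V : vectType R) (X : set V) :
    set (set V) :=
  [set K | exists2 x, X x &
    K = @vcoords R V @^-1` connected_component (@vcoords R V @` X) (vcoords x)].

(* [h H true] and [h H false] are H^+ and H^-. *)
Definition is_coorientation (R : realType) (V : vectType R)
    (A : {fset {vspace V}}) (h : A -> bool -> set V) : Prop :=
  forall H : A, h H true <> h H false /\
    components [set v : V | v \notin val H] = [set h H true; h H false].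

Definition cell (R : realType) (V : vectType R) (A : {fset {vspace V}})
    (h : A -> bool -> set V) (e : {ffun A -> bool}) (S : {set A}) : set V :=
  \bigcap_(H in [set` S]) h H (e H).

Definition consistent (R : realType) (V : vectType R) (A : {fset {vspace V}})
    (h : A -> bool -> set V) (k : nat) (e : {ffun A -> bool}) : Prop :=
  forall S : {set A}, (#|S| <= k.+1)%N -> cell h e S !=set0.

Definition sigma (R : realType) (V : vectType R) (A : {fset {vspace V}})
    (h : A -> bool -> set V) (k : nat) : nat :=
  #|[pred e : {ffun A -> bool} | `[< consistent h k e >]]|.

Definition yoshinaga_criterion (R : realType) (V : vectType R)
    (A : {fset {vspace V}}) (h : A -> bool -> set V) : Prop :=
  sigma h 2 = sigma h (\dim {:V}).

(* Main.v *)
(** Orient the linear forms so that each prescribed side [h H (e H)] is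
    [f H > 0]. By Gordan's alternative, an empty cell yields a nontrivial
    nonnegative linear dependency among these forms. One of minimal support is
    supported on a circuit [C]. If [#|C| >= 4], write [C] as the symmetric
    difference of circuits [D1] and [D2] meeting in [g]: the dependencies of
    [D1] and [D2] can be scaled to agree with that of [C] off [g] and to have
    opposite signs at [g], so one of them is a nonnegative dependency of smaller
    support. Hence some nonnegative dependency involves at most 3 hyperplanes,
    which contradicts 2-consistency. *)
Require Import Defs.
From mathcomp Require Import all_boot all_order all_algebra finmap.
From mathcomp Require Import boolp classical_sets reals topology normedtype.
From mathcomp Require Import ring lra zify.
Import Order.TTheory GRing.Theory Num.Theory.
Import numFieldNormedType.Exports.

Set Implicit Arguments.
Unset Strict Implicit.
Unset Printing Implicit Defensive.

Local Open Scope ring_scope.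

(** * Gordan's alternative for finitely many linear forms *)

(** With s the sum of [|y i| / x i] over [S], the choice e = 1 / (1 + s) works because |y i| <= s x
    i < (1 + s) x i. *)
Lemma small_perturbation (R : realFieldType) (T : finType) (S : {set T})
    (x y : T -> R) : (forall i, i \in S -> 0 < x i) ->
  exists2 e, 0 < e & forall i, i \in S -> 0 < x i + e * y i.
Proof.
move=> x_gt0; pose s := \sum_(i in S) `|y i| / x i.
have s_ge0 : 0 <= s.
  by apply: sumr_ge0 => i iS; rewrite divr_ge0 // ltW // x_gt0.
have s1_gt0 : 0 < 1 + s by lra.
exists (1 + s)^-1 => [|i iS]; first by rewrite invr_gt0.
have xi := x_gt0 i iS.
have : `|y i| / x i <= s.
  rewrite /s (bigD1 i) //= lerDl sumr_ge0 // => k /andP[kS _].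
  by rewrite divr_ge0 // ltW // x_gt0.
rewrite ler_pdivrMr // => ys.
rewrite -(pmulr_rgt0 _ s1_gt0) mulrDr mulrA mulfV ?gt_eqF // mul1r.
have := ler_norm (- y i); rewrite normrN; nra.
Qed.

(** Induction on the size of [S], eliminating one form [f j]. If a point [v] positive on the other
    forms has [f j v <= 0], the induction hypothesis is used again for the other forms restricted to
    the kernel of [f j]. *)
Lemma gordan (R : realFieldType) (V : vectType R) (T : finType)
    (f : T -> 'Hom(V, R^o)) (S : {set T}) :
  (exists v, forall i, i \in S -> 0 < (f i v : R)) \/
  (exists c : T -> R, [/\ forall i, i \in S -> 0 <= c i,
    exists2 i, i \in S & 0 < c i & \sum_(i in S) c i *: f i = 0]).
Proof.
have [n le_n] := ubnP #|S|.
elim: n => // n IH in f S le_n *.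
have [->|[j jS]] := set_0Vmem S; first by left; exists 0 => i; rewrite inE.
have ltn : (#|S :\ j| < n)%N by move: le_n; rewrite (cardsD1 j S) jS.
have sumE (c : T -> R) (a : R) :
    \sum_(i in S) (if i == j then a else c i) *: f i =
    a *: f j + \sum_(i in S :\ j) c i *: f i.
  rewrite (big_setD1 j) //= eqxx; congr (_ + _); apply: eq_bigr => i.
  by rewrite !inE => /andP[/negbTE->].
have [[v v_gt0]|[c [c_ge0 [i iS ci] c0]]] := IH f (S :\ j) ltn; last first.
  right; exists (fun i => if i == j then 0 else c i); split.
  - by move=> k kS; case: eqP => // /eqP kj; apply: c_ge0; rewrite !inE kj.
  - by move: iS; rewrite !inE => /andP[/negbTE ij iS]; exists i; rewrite ?ij.
  - by rewrite sumE c0 scale0r addr0.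
have [fjv|fjv] := ltP 0 (f j v : R).
  left; exists v => i iS; have [->//|ij] := eqVneq i j.
  by apply: v_gt0; rewrite !inE ij.
have [fj0|fj0] := eqVneq (f j) 0.
  right; exists (fun i => if i == j then 1 else 0); split.
  - by move=> i _; case: eqP.
  - by exists j => //; rewrite eqxx.
  - by rewrite sumE fj0 scaler0 add0r big1 // => i _; rewrite scale0r.
have [u fju] : exists u, f j u = 1.
  have [u fu] : exists u, f j u != 0.
    apply: contrapT => nex; case/eqP: fj0; apply/lfunP => v'; rewrite lfunE /=.
    by apply: contrapT => fv; apply: nex; exists v'; apply/eqP.
  by exists ((f j u)^-1 *: u); rewrite linearZ; exact: mulVf.
have fE i w (a : R) : f i (w + a *: u) = f i w + a * f i u :> R.
  by rewrite linearD linearZ.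
(* [f' i] is [f i] after projection onto [ker (f j)] along [u]. *)
pose f' i := f i - (f i u : R) *: f j.
have f'E i w : f' i w = f i w - f i u * f j w.
  by rewrite /f' add_lfunE opp_lfunE scale_lfunE.
have [[w w_gt0]|[c [c_ge0 [i iS ci] c0]]] := IH f' (S :\ j) ltn.
  have [e e_gt0 pos] :=
    small_perturbation (fun i => f i u : R) (x := fun i => f' i w) w_gt0.
  (* The point [w - f j w *: u] lies in the kernel of [f j], and each other [f i] takes the value
     [f' i w > 0] there. Adding [e *: u] makes [f j] equal to [e] and keeps the others positive. *)
  left; exists (w + (e - f j w) *: u) => i iS.
  have [->|ij] := eqVneq i j.
    by rewrite fE fju mulr1 addrC subrK.
  have := pos i; rewrite f'E !inE ij iS => /(_ isT) /=.
  by rewrite fE; lra.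
pose m : R := \sum_(i in S :\ j) c i * f i u.
have cE : \sum_(i in S :\ j) c i *: f i = m *: f j.
  apply/eqP; rewrite -subr_eq0 -[eqbRHS]c0 /m scaler_suml -sumrB; apply/eqP.
  by apply: eq_bigr => k _; rewrite scalerBr scalerA.
have [m_le0|m_gt0] := lerP m 0.
  right; exists (fun i => if i == j then - m else c i); split.
  - move=> k kS; case: eqP => [_|/eqP kj]; first by rewrite oppr_ge0.
    by apply: c_ge0; rewrite !inE kj.
  - by move: iS; rewrite !inE => /andP[/negbTE ij iS]; exists i; rewrite ?ij.
  - by rewrite sumE cE -scalerDl addNr scale0r.
(* For [m > 0], evaluating at [v] is contradictory: the left side of [cE] is positive, while
   [m * f j v <= 0]. *)
have /(congr1 (fun g : 'Hom(V, R^o) => g v : R)) := cE.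
rewrite sum_lfunE lfunE /= /GRing.scale /=.
have : 0 < \sum_(i in S :\ j) (c i *: f i) v :> R.
  rewrite (big_setD1 i) //= lfunE /= ltr_wpDr ?mulr_gt0 ?v_gt0 //.
  apply: sumr_ge0 => k; rewrite inE => /andP[_ kS]; rewrite lfunE /=.
  by rewrite mulr_ge0 ?c_ge0 // ltW ?v_gt0.
by move=> + E; rewrite E pmulr_rgt0 // ltNge fjv.
Qed.

(** * Linear dependencies, their supports and circuits *)

Definition supp (R : realFieldType) (T : finType) (c : T -> R) : {set T} :=
  [set i | c i != 0].

(** Coefficients are indexed by all of [T], so dependencies with different supports can be added
    directly. *)
Definition dependency (R : realFieldType) (W : vectType R) (T : finType)
    (w : T -> W) (c : T -> R) : Prop :=
  \sum_i c i *: w i = 0.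

Definition positive_dependency (R : realFieldType) (W : vectType R)
    (T : finType) (w : T -> W) (c : T -> R) : Prop :=
  [/\ dependency w c, forall i, 0 <= c i & supp c != finset.set0].

Definition vect_indep (R : realFieldType) (W : vectType R) (T : finType)
    (w : T -> W) (S : {set T}) : Prop :=
  free [seq w i | i <- enum S].

Section LinearMatroid.
Variables (R : realFieldType) (W : vectType R) (T : finType) (w : T -> W).
Implicit Types (c d : T -> R) (S C D : {set T}).

Lemma supp_out c S i : supp c \subset S -> i \notin S -> c i = 0.
Proof.
move=> /fintype.subsetP sc iS; apply/eqP; apply: contraNT iS => ci.
by apply: sc; rewrite inE.
Qed.

Lemma dependencyD c d (a b : R) : dependency w c -> dependency w d ->
  dependency w (fun i => a * c i + b * d i).
Proof.
rewrite /dependency => c0 d0.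
under eq_bigr do rewrite scalerDl -!scalerA.
by rewrite big_split /= -!scaler_sumr c0 d0 !scaler0 addr0.
Qed.

Lemma dependencyZ c (a : R) :
  dependency w c -> dependency w (fun i => a * c i).
Proof.
rewrite /dependency => c0; under eq_bigr do rewrite -scalerA.
by rewrite -scaler_sumr c0 scaler0.
Qed.

Lemma not_vect_indepP S : ~ vect_indep w S <->
  exists c, [/\ dependency w c, supp c \subset S & supp c != finset.set0].
Proof.
have sX : size [seq w i | i <- enum S] == #|S| by rewrite size_map cardE.
pose X := Tuple sX.
have nthX (i : 'I_#|S|) : X`_i = w (enum_val i).
  by rewrite (nth_map (enum_default i)) // -cardE.
rewrite /vect_indep -[[seq _ | _ <- _]]/(tval X).
split=> [nfree|[c [c0 cS cn0]]].
  have : ~ forall k, \sum_(i < #|S|) k i *: X`_i = 0 -> forall i, k i = 0.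
    by move=> /freeP.
  move=> /existsNP[k] /not_implyP[k0 /existsNP[i ki]].
  pose c j := \sum_(l | enum_val l == j) k l.
  have cE l : c (enum_val l) = k l.
    by rewrite /c (big_pred1 l) // => l'; rewrite /= (inj_eq enum_val_inj).
  have c_out j : j \notin S -> c j = 0.
    by move=> jS; rewrite /c big1 // => l /eqP jE; rewrite -jE enum_valP in jS.
  exists c; split.
  - rewrite /dependency (bigID (mem S)) /= [X in _ + X]big1 ?addr0; last first.
      by move=> j /c_out ->; rewrite scale0r.
    by rewrite big_enum_val -[RHS]k0; apply: eq_bigr => l _; rewrite cE nthX.
  - apply/fintype.subsetP => j; apply: contraLR => /c_out cj.
    by rewrite inE cj eqxx.
  - by apply/finset.set0Pn; exists (enum_val i); rewrite inE cE; apply/eqP.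
move=> /freeP/(_ (fun i => c (enum_val i))).
case/finset.set0Pn: cn0 => j jc; have jS := fintype.subsetP cS j jc.
have -> : \sum_(i < #|S|) c (enum_val i) *: X`_i = 0.
  under eq_bigr do rewrite nthX.
  rewrite -(big_enum_val (fun i => c i *: w i)) -[RHS]c0.
  rewrite [RHS](bigID (mem S)) /=.
  by rewrite [X in _ + X]big1 ?addr0 // => i /(supp_out cS)->; rewrite scale0r.
move=> /(_ erefl (enum_rank_in jS j)); rewrite enum_rankK_in // => cj.
by rewrite inE cj eqxx in jc.
Qed.

Lemma dependency_supp c : dependency w c -> supp c != finset.set0 ->
  ~ vect_indep w (supp c).
Proof. by move=> c0 cn0; apply/not_vect_indepP; exists c. Qed.

Local Notation circuit := (is_circuit (vect_indep w)).

Lemma circuit_min C S : circuit C -> ~ vect_indep w S -> S \subset C -> S = C.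
Proof. by move=> /minsetP[_ minC] /asboolPn; apply: minC. Qed.

Lemma circuit_dependency C : circuit C ->
  exists2 c, dependency w c & supp c = C.
Proof.
move=> cC; have /minsetP[/asboolPn/not_vect_indepP[c [c0 cS cn0]] _] := cC.
exists c => //; apply: circuit_min cC _ cS; exact: dependency_supp.
Qed.

(** Subtracting the multiple of [c] that agrees with [d] at one element of [C] leaves a dependency
    supported on a proper subset of [C], which must vanish by minimality. *)
Lemma circuit_dependency_unique C c d : circuit C -> dependency w c ->
  supp c = C -> dependency w d -> supp d \subset C ->
  exists m, forall i, d i = m * c i.
Proof.
move=> cC c0 cE d0 dC.
have [C0|[i iC]] := set_0Vmem C.
  exists 0 => i; rewrite mul0r; apply: supp_out dC _; by rewrite C0 inE.
have /eqP ci : c i != 0 by rewrite -cE inE in iC.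
pose m := d i / c i; exists m => k.
pose e := fun i => 1 * d i + (- m) * c i.
suff : e k = 0 by rewrite /e; lra.
have e0 : dependency w e by exact: dependencyD.
have eC : supp e \subset C.
  apply/fintype.subsetP => l; apply: contraLR => lC; rewrite inE negbK /e.
  by rewrite (supp_out dC lC) (@supp_out c C) ?cE // !mulr0 addr0.
apply/eqP; apply: contrapT => /negP ek.
have en0 : supp e != finset.set0 by apply/finset.set0Pn; exists k; rewrite inE.
have /setP/(_ i) := circuit_min cC (dependency_supp e0 en0) eC.
by rewrite iC inE /e /m mul1r mulNr divfK ?subrr ?eqxx //; apply/eqP.
Qed.

(* Subtracting the largest admissible multiple of a dependency carried by a
   proper subset of the support kills one more coefficient. *)
Lemma positive_dependency_shrink c : positive_dependency w c ->
  ~ circuit (supp c) ->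
  exists2 c', positive_dependency w c' & (#|supp c'| < #|supp c|)%N.
Proof.
move=> [c0 c_ge0 cn0] ncirc.
(* [d] comes from a circuit properly inside the support. The index [k] will keep the difference
   nonzero; the sign of [d] is chosen so that some [d l > 0], which makes the minimal ratio below
   exist. *)
have [d [[d0 dc [k dk ck]] [l dl]]] : exists d, [/\ dependency w d,
    supp d \subset supp c & exists2 k, d k = 0 & c k != 0] /\ exists l, 0 < d l.
  have /asboolPn := dependency_supp c0 cn0 => dep_c.
  have [B BC] := @minset_exists _ (fun S => ~~ `[< vect_indep w S >]) _ dep_c.
  move=> sBC.
  have [d d0 dB] := circuit_dependency BC.
  have : B != supp c by apply/eqP => BE; apply: ncirc; rewrite -BE.
  rewrite finset.eqEsubset sBC /= => /subsetPn[k kc kB].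
  have dk : d k = 0 by apply: (supp_out _ kB); rewrite dB.
  have /finset.set0Pn[l] : supp d != finset.set0.
    rewrite dB; apply/eqP => B0; have /minsetP[/asboolPn nB _] := BC.
    by apply: nB; rewrite B0 /vect_indep enum_set0 nil_free.
  rewrite inE neq_lt => /orP[dl|dl].
    exists (fun i => -1 * d i); split; last by exists l; lra.
    split; first exact: dependencyZ.
      apply/fintype.subsetP => i; rewrite inE mulN1r oppr_eq0 => di.
      by apply: (fintype.subsetP sBC); rewrite -dB inE.
    by exists k; [rewrite dk mulr0|move: kc; rewrite inE].
  exists d; split; last by exists l.
  split=> //; first by rewrite dB.
  by exists k => //; move: kc; rewrite inE.
pose P := [pred i | 0 < d i].
(* The minimal ratio [c i / d i] over [d i > 0] is the largest [t] for which [c - t d] stays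
   nonnegative; its coefficient at [i] becomes zero. *)
case: (Order.TotalTheory.arg_minP (fun i => c i / d i) (dl : P l)) =>
  i /= di min_i.
pose t := c i / d i; have t_ge0 : 0 <= t by rewrite divr_ge0 // ltW.
pose c' i := 1 * c i + - t * d i.
have c'i : c' i = 0 by rewrite /c' mul1r mulNr /t divfK ?subrr // gt_eqF.
have c'0 : dependency w c' by exact: dependencyD.
have c'c : supp c' \subset supp c.
  apply/fintype.subsetP => j; apply: contraLR => jc.
  rewrite inE negbK /c' (supp_out dc jc) (@supp_out c (supp c)) //.
  by rewrite !mulr0 addr0.
exists c'; first split=> //.
- move=> j; rewrite /c'; have [dj|dj] := ltP 0 (d j).
    by have := min_i j dj; rewrite ler_pdivlMr // -/t; lra.
  by have := c_ge0 j; nra.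
- by apply/finset.set0Pn; exists k; rewrite inE /c' dk mulr0 addr0 mul1r.
- apply: proper_card; rewrite properE c'c; apply/subsetPn; exists i.
    rewrite inE; apply: contraTneq di => /eqP ci.
    by rewrite (supp_out dc) ?ltxx // inE negbK.
  by rewrite inE c'i eqxx.
Qed.

(** * Shortening positive dependencies along chords *)

Hypothesis w_simple : forall S, (#|S| <= 2)%N -> vect_indep w S.
Hypothesis w_chordal : chordal_matroid (vect_indep w).

Lemma circuit_card C : circuit C -> (3 <= #|C|)%N.
Proof.
move=> /minsetP[/asboolPn nC _]; rewrite ltnNge; apply/negP => C2.
by apply: nC; apply: w_simple.
Qed.

Lemma positive_dependency_chord c : positive_dependency w c ->
  circuit (supp c) -> (4 <= #|supp c|)%N ->
  exists2 c', positive_dependency w c' & (#|supp c'| < #|supp c|)%N.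
Proof.
move=> [c0 c_ge0 cn0] cC /(w_chordal cC).
move=> [D1 [D2 [cD1 cD2 /eqP/cards1P[g Dg] CE]]].
have [D1_3 D2_3] := (circuit_card cD1, circuit_card cD2).
have /andP[gD1 gD2] : (g \in D1) && (g \in D2).
  by have := set11 g; rewrite -Dg inE.
(* As [D1] and [D2] have at least 3 elements each, this count makes both smaller than [supp c]. *)
have cardC : (#|supp c| + 2 = #|D1| + #|D2|)%N.
  rewrite CE -cardsUI Dg cardsD.
  rewrite (finset.setIidPr _) ?finset.sub1set ?inE ?gD1 //.
  rewrite cards1 -[2%N]/(1 + 1)%N addnA subnK // card_gt0.
  by apply/finset.set0Pn; exists g; rewrite inE gD1.
have D12 i : (i \in D1) && (i \in D2) = (i == g).
  by have /setP/(_ i) := Dg; rewrite !inE.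
have supC i : (c i != 0) = ((i \in D1) || (i \in D2)) && (i != g).
  by have /setP/(_ i) := CE; rewrite Dg !inE andbC.
have [a a0 aD] := circuit_dependency cD1.
have [b b0 bD] := circuit_dependency cD2.
have aE i : (a i != 0) = (i \in D1) by rewrite -aD inE.
have bE i : (b i != 0) = (i \in D2) by rewrite -bD inE.
have ag : a g != 0 by rewrite aE. have bg : b g != 0 by rewrite bE.
(* Cancelling at [g] leaves a dependency supported in the circuit [supp c], hence a multiple of
   [c]. *)
pose d i := b g * a i + - a g * b i.
have d0 : dependency w d by exact: dependencyD.
have dC : supp d \subset supp c.
  apply/fintype.subsetP => i; apply: contraLR; rewrite !inE !negbK => /eqP ci.
  have := supC i; rewrite ci eqxx /= /d.
  have [->|_] := eqVneq i g; first by rewrite mulrC mulNr subrr eqxx.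
  rewrite andbT -aE -bE => /esym/negbT; rewrite negb_or !negbK.
  by case/andP => /eqP-> /eqP->; rewrite !mulr0 addr0.
have [m dE] := circuit_dependency_unique cC c0 erefl d0 dC.
(* At any [i] in [D1] other than [g], [b i = 0], so [d i = b g * a i] is nonzero. *)
have m0 : m != 0.
  have /finset.set0Pn[i] : D1 :\ g != finset.set0.
    by rewrite -card_gt0; move: D1_3; rewrite (cardsD1 g) gD1; case: #|_|.
  rewrite !inE => /andP[ig iD1]; have := D12 i; rewrite iD1 (negbTE ig) /=.
  rewrite -bE => /negbT; rewrite negbK => /eqP bi.
  have := dE i; rewrite /d bi mulr0 addr0 => E; apply/eqP => m0.
  move/eqP: E; rewrite m0 mul0r mulf_eq0 (negbTE bg) /=.
  by rewrite -[_ == _]negbK aE iD1.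
(* Dividing by [m] gives [a' + b' = c]. The supports meet only in [g], so off [g] each of [a'] and
   [b'] is zero or equal to [c]; at [g], where [c] vanishes, they are opposite and nonzero. The one
   positive at [g] is the shorter positive dependency. *)
pose a' i := b g / m * a i; pose b' i := - a g / m * b i.
have sum_ab i : a' i + b' i = c i.
  have := dE i; rewrite /d /a' /b' => E; apply: (mulfI m0); rewrite -E.
  by field.
have supa' : supp a' = D1.
  apply/setP => i; rewrite !inE /a' -aE !mulf_eq0 invr_eq0.
  by rewrite (negbTE bg) (negbTE m0).
have supb' : supp b' = D2.
  apply/setP => i; rewrite !inE /b' -bE !mulf_eq0 invr_eq0 oppr_eq0.
  by rewrite (negbTE ag) (negbTE m0).
have nonneg_off (p q : T -> R) (P Q : {set T}) : supp p = P -> supp q = Q ->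
    (forall i, (i \in P) && (i \in Q) = (i == g)) ->
    (forall i, p i + q i = c i) -> 0 < p g -> forall i, 0 <= p i.
  move=> pP qQ PQ pq pg i; have [->|ig] := eqVneq i g; first exact: ltW.
  have [iP|iP] := boolP (i \in P); last by rewrite (@supp_out p P) ?pP.
  have := PQ i; rewrite iP (negbTE ig) /= => /negbT iQ.
  by have := pq i; rewrite (@supp_out q Q i) ?qQ // addr0 => ->.
have ne (D : {set T}) : g \in D -> D != finset.set0.
  by move=> gD; apply/finset.set0Pn; exists g.
have cg : a' g + b' g = 0.
  by rewrite sum_ab; apply/eqP; rewrite -[_ == _]negbK supC eqxx andbF.
have a'g : a' g != 0 by have := gD1; rewrite -supa' inE.
have [pos|neg] := ltP 0 (a' g).
  exists a'; last by rewrite supa'; move: cardC D2_3; lia.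
  split; [exact: dependencyZ | | by rewrite supa' ne].
  exact: (nonneg_off a' b' D1 D2).
exists b'; last by rewrite supb'; move: cardC D1_3; lia.
split; [exact: dependencyZ | | by rewrite supb' ne].
apply: (nonneg_off b' a' D2 D1) => // [i|i|]; first by rewrite andbC.
  by rewrite addrC.
by rewrite le_eqVlt (negbTE a'g) /= in neg; lra.
Qed.

(** Strong induction on the support size: above 3, a circuit is shortened by chordality, any other
    support by means of a circuit inside it. *)
Lemma chordal_positive_dependency c : positive_dependency w c ->
  exists2 c', positive_dependency w c' & (#|supp c'| <= 3)%N.
Proof.
have [n le_n] := ubnP #|supp c|.
elim: n => // n IH in c le_n *; move=> c_pos.
have [|lt3] := leqP #|supp c| 3; first by exists c.
have [c' c'_pos lt_c'] :
    exists2 c', positive_dependency w c' & (#|supp c'| < #|supp c|)%N.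
  have [cC|] := pselect (circuit (supp c)).
    exact: positive_dependency_chord.
  exact: positive_dependency_shrink.
by apply: (IH c') => //; apply: leq_trans lt_c' _.
Qed.

End LinearMatroid.

(** * Open half-spaces as connected components *)

Local Open Scope classical_set_scope.

Lemma rV_continuous (R : realType) (U : topologicalType) n (g : U -> 'rV[R]_n) :
  (forall i, continuous (fun t => g t 0 i)) -> continuous g.
Proof.
move=> gc x A [P Px sPA].
have : \forall t \near x, forall i : 'I_n, P 0 i (g t 0 i).
  by apply: filter_forall => i; exact/(gc i x)/Px.
apply: filterS => t Pt; apply: sPA => i j.
by rewrite ord1.
Qed.

Section Halfspaces.
Variables (R : realType) (V : vectType R).
Implicit Types (f : 'Hom(V, R^o)) (v x : V).

Definition vof_coords (w : 'rV[R]_(\dim {:V})) : V :=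
  \sum_i w 0 i *: (vbasis {:V})`_i.

Lemma vcoordsK : cancel (@vcoords R V) vof_coords.
Proof.
move=> v; rewrite [RHS](coord_vbasis (memvf v)) /vof_coords.
by apply: eq_bigr => i _; rewrite mxE.
Qed.

Lemma vof_coords_continuous f : continuous (fun w => f (vof_coords w) : R).
Proof.
have -> : (fun w => f (vof_coords w) : R) =
    (fun w => \sum_i w 0 i * f (vbasis {:V})`_i).
  apply/funext => w; rewrite linear_sum; apply: eq_bigr => i _.
  exact: linearZ.
elim: (index_enum _) => [|i r IHr] w.
  rewrite (_ : (fun _ => _) = (fun=> 0)); first exact: cst_continuous.
  by apply/funext => ?; rewrite big_nil.
rewrite (_ : (fun _ => _) = (fun w : 'rV_(\dim {:V}) =>
    w 0 i * f (vbasis {:V})`_i + \sum_(j <- r) w 0 j * f (vbasis {:V})`_j));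
  last first.
  by apply/funext => ?; rewrite big_cons.
apply: (@cvgD _ R^o _ _ _ _ _ _ _ _ (IHr w)).
by apply: continuousM; [exact: coord_continuous|exact: cst_continuous].
Qed.

Lemma vcoords_segment_continuous x v :
  continuous (fun t : R => vcoords (x + t *: v)).
Proof.
apply: rV_continuous => i.
have -> : (fun t : R => vcoords (x + t *: v) 0 i) =
    (fun t => coord (vbasis {:V}) i x + t * coord (vbasis {:V}) i v).
  by apply/funext => t; rewrite mxE linearD linearZ.
move=> t; apply: cvgD; first exact: cst_continuous.
by apply: continuousM; [exact: cvg_id|exact: cst_continuous].
Qed.

(** The component of [x] is the side where [f] has the sign of [f x], so [a = f x]. A segment from
    [x] to a point of that side avoids the kernel; conversely [f] maps the component onto an
    interval that misses 0. *)
Lemma component_halfspace f K :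
  components [set v : V | v \notin lker f] K ->
  exists2 a : R, a != 0 & K = [set v : V | 0 < a * f v].
Proof.
move=> [x /= fx ->]; rewrite memv_ker in fx; exists (f x) => //.
set X := [set v : V | _]; apply/seteqP; split=> v /=; last first.
  move=> fxv.
  pose g t := vcoords (x + t *: (v - x)).
  have gB : connected (g @` `[0, 1]).
    apply: connected_continuous_connected; first exact: segment_connected.
    by apply: continuous_subspaceT; exact: vcoords_segment_continuous.
  apply: (connected_component_max _ _ gB).
  - by exists 0; rewrite /= ?in_itv /= ?lexx ?ler01 // /g scale0r addr0.
  - move=> _ [t /= + <-]; rewrite in_itv /= => /andP[t0 t1].
    exists (x + t *: (v - x)) => //; rewrite /X /= memv_ker.
    rewrite linearD linearZ linearB /= /GRing.scale /=.
    have ffx : 0 < f x * f x :> R.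
      by rewrite lt_def mulf_neq0 //= -expr2 sqr_ge0.
    apply/eqP => E.
    (* The left side is a convex combination, with weights 1 - t and t, of the positive numbers
       [f x * f x] and [f x * f v]. *)
    have : f x * (f x + t * (f v - f x)) = 0 :> R by rewrite E mulr0.
    rewrite mulrDr mulrCA mulrBr.
    have [le_xv|lt_vx] := lerP (f x * f x) (f x * f v : R); nra.
  - by exists 1; rewrite /= ?in_itv /= ?lexx ?ler01 // /g scale1r subrKC.
set Y := connected_component _ _ => Yv.
have YX : Y `<=` @vcoords R V @` X  by exact: connected_component_sub.
have Yx : Y (vcoords x).
  by apply: connected_component_refl; exists x; rewrite // /X /= memv_ker.
pose F w : R := f (vof_coords w).
have : connected (F @` Y).
  apply: connected_continuous_connected; first exact: component_connected.
  by apply: continuous_subspaceT; exact: vof_coords_continuous.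
move=> /connected_intervalP FY.
have Ffx : (F @` Y) (f x) by exists (vcoords x); rewrite // /F vcoordsK.
have Ffv : (F @` Y) (f v) by exists (vcoords v); rewrite // /F vcoordsK.
have F0 : ~ (F @` Y) 0.
  move=> [w /YX[u uX <-]]; rewrite /F vcoordsK => fu.
  by move: uX; rewrite /X /= memv_ker fu eqxx.
rewrite ltNge; apply/negP => fxv; apply: F0.
have [fx0|fx0] := ltP 0 (f x : R).
  by apply: (FY _ _ Ffv Ffx); rewrite (ltW fx0) andbT -(pmulr_rle0 _ fx0).
rewrite le_eqVlt (negbTE fx) /= in fx0.
by apply: (FY _ _ Ffx Ffv); rewrite (ltW fx0) /= -(nmulr_rle0 _ fx0).
Qed.

(** Project along [H] onto a complement, which is a line, and take the coordinate on that line. *)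
Lemma hyperplane_lker (H : {vspace V}) :
  is_hyperplane H -> exists f, lker f = H.
Proof.
move=> dimH.
have HC0 : (H :&: H^C = 0)%VS by rewrite capv_compl.
have CH0 : (H^C :&: H = 0)%VS by rewrite capvC.
have dimC : \dim (H^C)%VS = 1%N by rewrite dimv_compl -dimH subSnn.
have i0 : 'I_(\dim (H^C)%VS) by rewrite dimC; exact: ord0.
have i0E i : i = i0.
  by apply/val_inj; case: i i0 => i ? [j ?] /=; lia.
pose p := daddv_pi (H^C)%VS H.
have p_add v : p v + daddv_pi H (H^C)%VS v = v.
  by rewrite daddv_pi_add // addvC addv_complf memvf.
pose f : 'Hom(V, R^o) := linfun (coord (vbasis (H^C)%VS) i0 \o p).
exists f; apply/vspaceP => v; rewrite memv_ker lfunE /=.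
apply/eqP/idP => [pv0|vH].
  have -> : v = daddv_pi H (H^C)%VS v.
    rewrite -[LHS]p_add [p v](coord_vbasis (memv_pi _ _ _)).
    rewrite big1 ?add0r // => i _.
    by rewrite (i0E i) pv0 scale0r.
  exact: memv_pi.
have := p_add v; rewrite (daddv_pi_id HC0 vH) => /(canRL (addrK _)).
by rewrite subrr => ->; rewrite linear0.
Qed.

End Halfspaces.

(** * The matroid of the arrangement and consistent sign vectors *)

(** If [f u] is nonzero, [v - (f v / f u) *: u] lies in the common kernel, so [g] is determined by
    [g u]. *)
Lemma lker_scale (R : fieldType) (V : vectType R) (f g : 'Hom(V, R^o)) :
  lker f = lker g -> exists2 a : R, a != 0 & g = a *: f.
Proof.
move=> fg; have [f0|] := eqVneq f 0.
  exists 1; rewrite ?oner_neq0 // scale1r f0; apply/lfunP => v.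
  by apply/eqP; rewrite lfunE /= -memv_ker -fg memv_ker f0 lfunE.
move=> fn0; have [u fu] : exists u, f u != 0.
  apply: contrapT => nex; case/eqP: fn0; apply/lfunP => v; rewrite lfunE /=.
  by apply: contrapT => fv; apply: nex; exists v; apply/eqP.
have gu : g u != 0 by rewrite -memv_ker -fg memv_ker.
exists (g u / f u); first by rewrite mulf_neq0 ?invr_eq0.
apply/lfunP => v; have : v - (f v / f u) *: u \in lker g.
  rewrite -fg memv_ker linearB linearZ /= /GRing.scale /= divfK ?subrr //.
rewrite memv_ker linearB linearZ subr_eq0 => /eqP->.
by rewrite lfunE /= /GRing.scale /= mulrAC [f v * _]mulrC mulrAC.
Qed.

Section Arrangement.
Variables (R : realType) (V : vectType R) (A : {fset {vspace V}}).

Lemma halfspace_form (h : A -> bool -> set V) (H : A) (b : bool) :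
  is_hyperplane (val H) -> is_coorientation h ->
  exists2 f : 'Hom(V, R^o), lker f = val H &
    h H b = [set v : V | 0 < (f v : R)].
Proof.
move=> hypH /(_ H)[_ compE]; have [f fH] := hyperplane_lker hypH.
have : components [set v : V | v \notin lker f] (h H b).
  by rewrite fH compE; case: b; [left|right].
case/component_halfspace => a a0 hE; exists (a *: f).
  apply/vspaceP => v; rewrite -fH !memv_ker lfunE /= /GRing.scale /=.
  by rewrite mulf_eq0 (negbTE a0).
by rewrite hE; apply/seteqP; split=> v /=; rewrite lfunE.
Qed.

Variables (f : A -> 'Hom(V, R^o)) (hypA : forall H : A, is_hyperplane (val H)).
Hypothesis f_ker : forall H : A, lker (f H) = val H.

(** Two choices of forms differ by nonzero scalars, and rescaling vectors preserves the supports of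
    dependencies. *)
Lemma arr_indepE : @arr_indep R V A = vect_indep f.
Proof.
apply/funext => S; apply/propext; split; last by exists f.
move=> [g [g_ker g_free]].
have /choice[a a_spec] : forall H : A, exists a : R, a != 0 /\ f H = a *: g H.
  move=> H; have [|a a0 E] := @lker_scale _ _ (g H) (f H); last by exists a.
  by rewrite g_ker.
apply: contrapT => /not_vect_indepP[c [c0 cS cn0]].
suff : ~ vect_indep g S by apply.
apply/not_vect_indepP; exists (fun H => c H * a H).
have -> : supp (fun H => c H * a H) = supp c.
  by apply/setP => H; rewrite !inE mulf_eq0 negb_or (proj1 (a_spec H)) andbT.
split=> //; rewrite /dependency -[RHS]c0; apply: eq_bigr => H _.
by rewrite (proj2 (a_spec H)) scalerA.
Qed.

(** Forms of hyperplanes are nonzero, and two proportional forms would have the same kernel, whereas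
    the elements of [A] are distinct. *)
Lemma hyperplane_forms_simple (S : {set A}) : (#|S| <= 2)%N -> vect_indep f S.
Proof.
have f0 (H : A) : f H != 0.
  apply/eqP => fH0; have := hypA H; rewrite /is_hyperplane -f_ker fH0.
  rewrite (_ : lker 0 = fullv); first by lia.
  by apply/vspaceP => v; rewrite memv_ker lfunE eqxx memvf.
move=> S2; apply: contrapT => /not_vect_indepP[c [c0 cS /finset.set0Pn[H]]].
rewrite inE => cH; have HS : H \in S.
  by apply: (fintype.subsetP cS); rewrite inE.
move: c0; rewrite /dependency (bigD1 H) //=.
have [S1|[K]] := set_0Vmem (S :\ H)%SET.
  rewrite big1 ?addr0 => [/eqP|K KH].
    by rewrite scaler_eq0 (negbTE cH) (negbTE (f0 H)).
  rewrite (supp_out cS) ?scale0r //; apply/negP => KS.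
  by have /setP/(_ K) := S1; rewrite !inE KH KS.
rewrite !inE => /andP[KH KS]; rewrite (bigD1 K) //= big1 ?addr0; last first.
  move=> L /andP[LH LK]; rewrite (supp_out cS) ?scale0r //; apply/negP => LS.
  have : ([set H; K; L]%SET \subset S).
    by apply/fintype.subsetP => M; rewrite !inE -orbA => /or3P[] /eqP->.
  move=> /subset_leq_card; rewrite -finset.setUA finset.cardsU1 cards2.
  rewrite !inE negb_or.
  by rewrite ![H == _]eq_sym [K == L]eq_sym KH LH LK => /leq_trans/(_ S2).
move=> /eqP; rewrite addr_eq0 => /eqP E; case/eqP: KH; apply: val_inj.
have cK : c K != 0.
  apply: contraNneq (f0 H) => cK; move/eqP: E; rewrite cK scale0r oppr0.
  by rewrite scaler_eq0 (negbTE cH).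
rewrite -!f_ker; apply/vspaceP => v; rewrite !memv_ker.
have /(congr1 (fun g : 'Hom(V, R^o) => g v)) := E.
rewrite opp_lfunE !scale_lfunE => Ev; rewrite -[LHS](mulrI_eq0 _ (mulfI cK)).
by rewrite -oppr_eq0 -[X in X == 0]Ev mulrI_eq0 //; exact: mulfI.
Qed.

(** A point positive on all forms lies in every cell. Otherwise there is a positive dependency among
    at most 3 = 2 + 1 forms; at a point of the cell of its support, given by 2-consistency, the zero
    sum would be positive. *)
Lemma consistent_cell_nonempty (h : A -> bool -> set V) (e : {ffun A -> bool}) :
  (forall H, h H (e H) = [set v : V | 0 < (f H v : R)]) ->
  chordal_arrangement A -> consistent h 2 e ->
  forall S, cell h e S !=set0.
Proof.
move=> hE; rewrite /chordal_arrangement arr_indepE => chordA cons S.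
have [[v v_gt0]|[c [c_ge0 [H _ cH] c0]]] := gordan f [set: A]%SET.
  by exists v => H _; rewrite hE /=; apply: v_gt0; rewrite inE.
have c_pos : positive_dependency f c.
  split; [|by move=> K; apply: c_ge0; rewrite inE|].
    by rewrite /dependency -[RHS]c0; apply: eq_bigl => K; rewrite inE.
  by apply/finset.set0Pn; exists H; rewrite inE gt_eqF.
have [d [d0 d_ge0 /finset.set0Pn[K dK]] d3] :=
  chordal_positive_dependency hyperplane_forms_simple chordA c_pos.
rewrite inE in dK; have [v vcell] := cons _ d3.
have term_ge0 L : 0 <= d L * f L v :> R.
  have [dL|dL] := eqVneq (d L) 0; first by rewrite dL mul0r.
  have := vcell L; rewrite hE /= inE => /(_ dL) fL.
  by rewrite mulr_ge0 // ltW.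
have := congr1 (fun g : 'Hom(V, R^o) => g v : R) d0.
rewrite sum_lfunE lfunE /= => sum0.
have : 0 < \sum_L (d L *: f L) v :> R; last by rewrite sum0 ltxx.
rewrite (bigD1 K) //= ltr_wpDr ?sumr_ge0 // => [L _|].
  by rewrite scale_lfunE; exact: term_ge0.
rewrite scale_lfunE /= lt_def mulf_neq0 ?term_ge0 // gt_eqF //.
by have := vcell K; rewrite hE /= inE => /(_ dK).
Qed.

(** In dimension at most 1 only the zero subspace can be a hyperplane. *)
Lemma card_low_dim (S : {set A}) : (\dim {:V} <= 1)%N -> (#|S| <= 1)%N.
Proof.
move=> dV; apply/card_le1_eqP => H K _ _; apply: val_inj.
have zero (L : A) : val L = 0%VS.
  by apply/eqP; rewrite -dimv_eq0; have := hypA L; rewrite /is_hyperplane; lia.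
by rewrite !zero.
Qed.

End Arrangement.

Theorem theorem3p2 (R : realType) (V : vectType R) (A : {fset {vspace V}})
    (h : A -> bool -> set V) :
  is_essential_arrangement A ->
  is_coorientation h ->
  chordal_arrangement A ->
  yoshinaga_criterion h.
Proof.
move=> [hypA _] coor chordA.
have hyp (H : A) : is_hyperplane (val H) by apply: hypA; exact: valP.
apply: eq_card => e; rewrite !inE.
apply/asboolP/asboolP => cons S cardS; last first.
  (* With r the dimension, r-consistency gives 2-consistency: for r >= 2 the sets of at most 3
     elements are among those tested, and for r <= 1 every set has at most one element. *)
  have [dV|dV] := leqP (\dim {:V}) 1.
    by apply: cons; apply: leq_trans (card_low_dim hyp S dV) _.
  by apply: cons; apply: leq_trans cardS _.
(* Conversely, choose forms positive on the sides prescribed by [e]; then every cell is nonempty,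
   whatever the size of [S]. *)
have /choice[f f_spec] : forall H : A, exists f : 'Hom(V, R^o),
    lker f = val H /\ h H (e H) = [set v : V | 0 < (f v : R)].
  by move=> H; have [f fH hE] := halfspace_form (e H) (hyp H) coor; exists f.
apply: (@consistent_cell_nonempty R V A f) => // H; first by case: (f_spec H).
by case: (f_spec H).
Qed.
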